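(* Let $f \in \mathbb{Z}[x]$ be a tower-stable polynomial, let $a$ be a positive integer, and let $b$ be an $f$-valid positive integer. Then there exists a sequence of positive integers $(x_n)_{n \ge 1}$ such that for every $n \ge 1$, $$f^{x_n}(a) \equiv x_n \pmod{b^n},$$ and for every $n \ge 2$, $x_n = c_n b^{n-1} + x_{n-1}$ for some integer $c_n$ with $0 \le c_n < b$.
   Context: $f^m$ denotes the $m$-th iterate of $f$. For a positive integer $m$, $f_m : \mathbb{Z}/m\mathbb{Z} \to \mathbb{Z}/m\mathbb{Z}$ denotes the reduction map $x \bmod m \mapsto f(x) \bmod m$. For a self-map $\sigma$ of a finite set $F$ and $y \in F$, the cycle length of $\sigma$ on $y$ is the least $l \ge 1$ such that $\sigma^{k}(y) = \sigma^{k+l}(y)$ for some $k \ge 0$; the period of $\sigma$ is the least common multiple of the cycle lengths of all $y \in F$. Let $\lambda_f(m)$ denote the period of $f_m$. The polynomial $f$ is called tower-stable if for every prime $p$, $f_p$ is not a cyclic permutation of length $p$ (a single cycle through all $p$ elements). A positive integer $b$ is called valid if for every pair of primes $p, q$ with $p \mid b$ and $q \mid p-1$ we have $q \mid b$. A positive integer $b$ is called $f$-valid if $b$ is square-free, valid, and for every pair of primes $p, q$ with $p \mid b$ and $q \mid \lambda_f(p)$ we have $q \mid b$. *)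

(* Defs.v *)
From mathcomp Require Import all_boot all_order all_algebra.
From mathcomp Require Import boolp.
Set Implicit Arguments. Unset Strict Implicit. Unset Printing Implicit Defensive.
Import GRing.Theory Num.Theory.

Definition piter (f : {poly int}) (m : nat) (x : int) : int :=
  iter m (fun y => f.[y]%R) x.

(* Reduction map f_m : Z/mZ -> Z/mZ, with Z/mZ represented by 'I_m
   (residues 0..m-1); x mod m |-> f(x) mod m.  The outer [%% m] on nat is
   a no-op (the value is already < m) used only to get the bound proof. *)
Definition redf_val (f : {poly int}) (m : nat) (x : 'I_m) : nat :=
  `|(f.[(x : nat)%:Z] %% m%:Z)%Z|%N.

Lemma redf_lt (f : {poly int}) (m : nat) (x : 'I_m) : (redf_val f x %% m < m)%N.
Proof. by rewrite ltn_pmod // (leq_ltn_trans (leq0n x) (ltn_ord x)). Qed.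

Definition redf (f : {poly int}) (m : nat) (x : 'I_m) : 'I_m :=
  Ordinal (redf_lt f x).

Definition is_cycle_len (T : finType) (sigma : T -> T) (y : T) (l : nat) : Prop :=
  (0 < l)%N /\ exists k : nat, iter k sigma y = iter (k + l) sigma y.

Lemma cycle_len_exists (T : finType) (sigma : T -> T) (y : T) :
  exists l, `[< is_cycle_len sigma y l >].
Proof.
pose g (i : 'I_#|T|.+1) := iter i sigma y.
have : ~~ injectiveb g.
  apply/negP => /injectiveP inj; have := @leq_card _ _ g inj.
  by rewrite card_ord ltnn.
case/injectivePn => i [j nij eqg].
wlog lt_ij : i j nij eqg / (i < j)%N.
  move=> H; have [lt|gt|eq] := ltngtP i j; first exact: (H i j).
    by apply: (H j i) => //; rewrite eq_sym.
  by move: nij; rewrite -val_eqE /= eq eqxx.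
exists (j - i)%N; apply/asboolP; split; first by rewrite subn_gt0.
exists i; rewrite subnKC; last exact: ltnW.
exact: eqg.
Qed.

Definition cycle_len (T : finType) (sigma : T -> T) (y : T) : nat :=
  ex_minn (cycle_len_exists sigma y).

Definition period (T : finType) (sigma : T -> T) : nat :=
  \big[lcmn/1%N]_(y : T) cycle_len sigma y.

Definition lambda (f : {poly int}) (m : nat) : nat := period (@redf f m).

Definition full_cycle (T : finType) (sigma : T -> T) : Prop :=
  injective sigma /\ forall x y : T, exists k : nat, iter k sigma x = y.

Definition tower_stable (f : {poly int}) : Prop :=
  forall p : nat, prime p -> ~ full_cycle (@redf f p).

Definition valid (b : nat) : Prop :=
  (0 < b)%N /\
  forall p q : nat, prime p -> prime q -> (p %| b)%N -> (q %| p.-1)%N -> (q %| b)%N.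

Definition squarefree (b : nat) : Prop :=
  (0 < b)%N /\ forall p : nat, prime p -> ~~ (p ^ 2 %| b)%N.

Definition f_valid (f : {poly int}) (b : nat) : Prop :=
  squarefree b /\ valid b /\
  forall p q : nat, prime p -> prime q -> (p %| b)%N -> (q %| lambda f p)%N ->
    (q %| b)%N.

(* Main.v *)
(** Write u_k = f^k(a) and let L be the cycle length of a modulo a prime p
dividing b.  Tower-stability forces L < p, so D = L (p - 1) has only prime
factors that divide b and are smaller than p.  By a Taylor expansion,
u is eventually periodic modulo p^(n+1) with period D p^n: either p divides
f' somewhere on the cycle and u is eventually D-periodic modulo every p^n, or
the multiplier of f^D is 1 modulo p and each further power of p multiplies the
period by p.

If M is an eventual period of u modulo M s, a solution of u_x = x modulo M
along a residue class of x modulo M lifts uniquely to a class modulo M s.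
Lifting one prime at a time, in increasing order, gives a solution modulo b^N;
from there on the modulus can be multiplied by b, which produces the digits c_n.

This yields u_k = x_n modulo b^n only for large k = x_n modulo b^n, and x_n may
lie below the preperiod modulo b^n, since arbitrarily long runs of digits can
vanish.  The preperiod modulo p^n grows only linearly in n, and only in the
attracting case.  There p^n divides F(x_n) for the nonzero polynomial
F = f^D - X, so once x_n exceeds the integer roots of F, it is exponentially
large in n and hence beyond the preperiod.  So it suffices to start with a
large x_N, and to take x_n = x_N for n < N. *)
Require Import Defs.
From mathcomp Require Import all_boot all_order all_algebra all_solvable.
From mathcomp Require Import boolp ring zify.
Set Implicit Arguments. Unset Strict Implicit. Unset Printing Implicit Defensive.
Import Order.TTheory GRing.Theory Num.Theory intdiv.
Local Open Scope ring_scope.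

Lemma dvdz_sub_trans (d y x z : int) :
  (d %| x - y)%Z -> (d %| y - z)%Z -> (d %| x - z)%Z.
Proof. by move=> h1 h2; rewrite -(subrKA y) rpredD. Qed.

Lemma dvdz_sub_sym (d x y : int) : (d %| x - y)%Z -> (d %| y - x)%Z.
Proof. by rewrite -opprB rpredN. Qed.

Lemma horner_taylor (f : {poly int}) (y e : int) :
  exists w, f.[y + e] = f.[y] + e * f^`().[y] + e ^+ 2 * w.
Proof.
elim/poly_ind: f => [|q c [w IH]]; first by exists 0; rewrite deriv0 !horner0; ring.
exists (q^`().[y] + w * (y + e)).
by rewrite derivD derivM derivX derivC !hornerE IH; ring.
Qed.

Lemma dvdz_horner (f : {poly int}) (d x y : int) :
  (d %| x - y)%Z -> (d %| f.[x] - f.[y])%Z.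
Proof.
move=> h; have [w] := horner_taylor f y (x - y).
rewrite addrC subrK => ->; have -> : forall A B C : int, A + (x - y) * B + (x - y) ^+ 2 * C - A
  = (x - y) * (B + (x - y) * C) by move=> A B C; ring.
exact: dvdz_mulr.
Qed.

Lemma piterS f m x : piter f m.+1 x = f.[piter f m x].
Proof. by []. Qed.

Lemma piterD f m n x : piter f (m + n) x = piter f n (piter f m x).
Proof. by rewrite addnC /piter iterD. Qed.

Lemma dvdz_piter f m (d x y : int) :
  (d %| x - y)%Z -> (d %| piter f m x - piter f m y)%Z.
Proof. by move=> h; elim: m => [//|m IH]; rewrite !piterS; apply: dvdz_horner. Qed.

(** Chain rule: the product is the derivative of the [m]-th iterate at [y]. The quadratic error is a
    multiple of [d ^+ 2], hence of [d * p]. *)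
Lemma piter_taylor f m (p d x y : int) : (p %| d)%Z -> (d %| x - y)%Z ->
  (d * p %| piter f m x - piter f m y
            - (x - y) * \prod_(i < m) f^`().[piter f i y])%Z.
Proof.
move=> /dvdzP [d' ed] dxy; elim: m => [|m /dvdzP [w IH]].
  by rewrite big_ord0 mulr1 subrr dvdz0.
rewrite !piterS big_ord_recr mulrA.
have /dvdzP [v ev] := dvdz_piter f m dxy.
have [z] := horner_taylor f (piter f m y) (piter f m x - piter f m y).
rewrite addrC subrK => ->.
move: IH ev; set X := piter f m x; set Y := piter f m y; set W := \prod_(i < m) _.
move=> IH ev; apply/dvdzP; exists (w * f^`().[Y] + d' * v ^+ 2 * z).
have -> : (X - Y) ^+ 2 = v * d * (v * d) by rewrite -ev; ring.
have -> : X - Y = w * (d * p) + (x - y) * W by rewrite -IH; ring.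
by rewrite ed; ring.
Qed.

Lemma piter_poly f m : exists h : {poly int}, forall x, h.[x] = piter f m x.
Proof.
elim: m => [|m [h IH]]; first by exists 'X => x; rewrite hornerX.
by exists (f \Po h) => x; rewrite horner_comp IH.
Qed.

(** * Growth of integer polynomials *)

Lemma poly_neq0_eventually (F : {poly int}) : F != 0 ->
  exists X0 : nat, forall k : nat, (X0 <= k)%N -> F.[k%:Z] != 0.
Proof.
elim/poly_ind: F => [|q c IH]; first by rewrite eqxx.
have [-> |c0 _] := eqVneq c 0.
  rewrite addr0 mulf_eq0 polyX_eq0 orbF => /IH [X0 hX]; exists X0.+1 => k hk.
  by rewrite hornerM hornerX mulf_neq0 ?hX //; lia.
(* A root [k] divides the constant coefficient [c], so it cannot exceed [|c|]. *)
exists `|c|%N.+1 => k hk; apply/eqP; rewrite !hornerE => e.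
have : (k%:Z %| c)%Z.
  by apply/dvdzP; exists (- q.[k%:Z]); move: e => /(canRL (addKr _)) ->; ring.
rewrite dvdzE => /dvdn_leq; rewrite absz_nat absz_gt0 => /(_ c0); lia.
Qed.

Lemma poly_growth (F : {poly int}) : exists C d : nat, forall k : nat,
  (absz F.[k%:Z] <= C * k.+1 ^ d)%N.
Proof.
elim/poly_ind: F => [|q c [C [d IH]]].
  by exists 0%N, 0%N => k; rewrite horner0.
exists (C + absz c)%N, d.+1 => k; rewrite !hornerE.
have h1 : (absz (q.[k%:Z] * k%:Z + c)%R <= absz q.[k%:Z] * k + absz c)%N.
  by rewrite -[X in (_ <= _ * X + _)%N]/(absz k) -abszM; lia.
apply: (leq_trans h1); rewrite mulnDl leq_add //.
  by rewrite expnSr mulnA leq_mul.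
by rewrite leq_pmulr // expn_gt0.
Qed.

Lemma leq_expl (m n e : nat) : (m <= n -> m ^ e <= n ^ e)%N.
Proof. by case: e => // e h; rewrite leq_exp2r. Qed.

(** With [m = n %/ d.+1], the right side is at least [m.+1 ^ d.+1] and the left at most a constant
    times [m.+1 ^ d]. *)
Lemma exp_beats_pow (C d : nat) : exists n0, forall n,
  (n0 <= n)%N -> (C * n.+1 ^ d < 2 ^ n)%N.
Proof.
set C' := (C * d.+1 ^ d)%N.
exists (C'.+1 * d.+1)%N => n hn; set m := (n %/ d.+1)%N.
have hm : (C'.+1 <= m)%N by rewrite leq_divRL.
have h1 : (n.+1 <= d.+1 * m.+1)%N by rewrite mulnC ltn_ceil.
have h2 : (m.+1 ^ d.+1 <= 2 ^ n)%N.
  have h : (m < 2 ^ m)%N by apply: ltn_expl.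
  have h' : (m.+1 ^ d.+1 <= (2 ^ m) ^ d.+1)%N by rewrite leq_exp2r.
  by apply: leq_trans h' _; rewrite -expnM leq_pexp2l // leq_trunc_div.
apply: leq_trans h2; rewrite expnS.
apply: (@leq_ltn_trans (C' * m.+1 ^ d)%N).
  by rewrite -mulnA leq_mul2l -expnMn leq_expl ?orbT.
by rewrite ltn_pmul2r ?expn_gt0 //; apply: (leq_trans hm).
Qed.

(** If [k < A + B * n], the nonzero value of [F] at [k] is polynomially bounded in [n], so for large
    [n] it is no multiple of [p ^ n]. *)
Lemma poly_dvd_pow2 (F : {poly int}) (A B : nat) : F != 0 ->
  exists X0 : nat, forall k n p : nat, (X0 <= k)%N -> (1 < p)%N ->
    ((p ^ n)%N %| F.[k%:Z])%Z -> (A + B * n <= k)%N.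
Proof.
move=> /poly_neq0_eventually [X0 nz].
have [C [d hC]] := poly_growth F.
have [n0 hn0] := exp_beats_pow (C * (A + B).+1 ^ d) d.
exists (X0 + A + B * n0)%N => k n p hk p1; rewrite dvdzE absz_nat => /dvdn_leq.
rewrite absz_gt0 nz; last by lia.
move=> /(_ isT) hle; rewrite leqNgt; apply/negP => hlt.
have [hn|hn] := ltnP n n0.
  by have := leq_mul (leqnn B) (ltnW hn); lia.
have := hn0 n hn; rewrite ltnNge => /negP; apply.
rewrite (@leq_trans (p ^ n)%N) ?leq_expl //.
apply: (leq_trans hle); apply: (leq_trans (hC k)).
rewrite -mulnA leq_mul2l -expnMn; apply/orP; right.
by apply: leq_expl; nia.
Qed.

(** * Orbits modulo prime powers *)

Definition evper (f : {poly int}) (a : int) (m M : nat) : Prop :=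
  exists K : nat, forall k : nat, (K <= k)%N ->
    (m %| piter f (k + M) a - piter f k a)%Z.

Lemma dvdz_piter_addM f a (m M K t : nat) :
  (forall k : nat, (K <= k)%N -> (m %| piter f (k + M) a - piter f k a)%Z) ->
  forall k : nat, (K <= k)%N -> (m %| piter f (k + t * M) a - piter f k a)%Z.
Proof.
move=> h k hk; elim: t => [|t IH]; first by rewrite addn0 subrr dvdz0.
apply: dvdz_sub_trans IH; rewrite mulSn addnCA addnC; apply: h; lia.
Qed.

(** Otherwise, by minimality of the cycle length, [#|T|] consecutive points past the preperiod are
    distinct and exhaust [T]. *)
Lemma cycle_len_lt (T : finType) (s : T -> T) (y : T) :
  ~ full_cycle s -> (cycle_len s y < #|T|)%N.
Proof.
move=> nfull; rewrite ltnNge; apply/negP => hle; apply: nfull.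
rewrite /cycle_len in hle; case: ex_minnP hle => l /asboolP [l0 [k hk]] hmin hle.
pose g (i : 'I_#|T|) := iter (k + i) s y.
have kper n : iter (k + n + l) s y = iter (k + n) s y.
  by rewrite addnAC addnC iterD -hk -iterD addnC.
have ginj : injective g.
  move=> i j; wlog lt_ij : i j / (i < j)%N.
    move=> H; have [lt|gt|/val_inj //] := ltngtP i j; first exact: H.
    by move=> /esym/H ->.
  move=> e; have : (l <= j - i)%N.
    apply: hmin; apply/asboolP; split; first by rewrite subn_gt0.
    by exists (k + i)%N; rewrite -addnA subnKC 1?ltnW.
  by have := ltn_ord j; lia.
have [g' gK g'K] : bijective g by apply: inj_card_bij; rewrite ?card_ord.
have kperM n t : iter (k + n + t * l) s y = iter (k + n) s y.
  by elim: t => [|t IH]; rewrite ?addn0 // mulSn addnCA addnC -(addnA k n) kper addnA.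
(* Going [l.-1] steps further around the cycle inverts [s]. *)
have sK : cancel (fun z => iter (k + g' z + l.-1) s y) s.
  move=> z; rewrite -iterS -addnS prednK // kper; exact: g'K.
split; first exact: can_inj (canF_sym sK).
(* The added multiple of [l] makes the truncated subtraction exact. *)
move=> x z; exists (g' z + g' x * l - g' x)%N.
have iter_x n : iter n s x = iter (n + (k + g' x)) s y.
  by rewrite iterD -[in LHS](g'K x).
rewrite iter_x.
have -> : (g' z + g' x * l - g' x + (k + g' x) = k + g' z + g' x * l)%N by nia.
by rewrite kperM; apply: g'K.
Qed.

Lemma redf_iter f a (p k : nat) (y : 'I_p) : (p %| y%:Z - a)%Z ->
  (p %| (iter k (@redf f p) y : nat)%:Z - piter f k a)%Z.
Proof.
move=> h; elim: k => [//|k IH].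
rewrite piterS iterS; apply: dvdz_sub_trans (dvdz_horner f IH).
set z := iter k _ y; rewrite /= modn_small; last first.
  have p0 : (0 < p)%N := leq_ltn_trans (leq0n y) (ltn_ord y).
  rewrite /redf_val -ltz_nat gez0_abs ?ltz_pmod ?modz_ge0 //; lia.
have p0 : (0 < p)%N := leq_ltn_trans (leq0n y) (ltn_ord y).
rewrite /redf_val gez0_abs ?modz_ge0 //; last by lia.
by rewrite -eqz_mod_dvd modz_mod.
Qed.

Lemma orbit_cycle f a (p : nat) : prime p -> tower_stable f ->
  exists L, [/\ (0 < L)%N, (L < p)%N, (L %| lambda f p)%N & evper f a p L].
Proof.
move=> p_pr ts; have p0 := prime_gt0 p_pr.
have hy : (`|(a %% p)%Z| < p)%N.
  by rewrite -ltz_nat gez0_abs ?ltz_pmod ?modz_ge0 //; lia.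
pose y := Ordinal hy.
have ya : (p %| y%:Z - a)%Z.
  have pZ : p%:Z != 0 by lia.
  have e : y%:Z = (a %% p)%Z by rewrite gez0_abs // modz_ge0.
  by rewrite e -eqz_mod_dvd modz_mod.
have [l0 [k0 hk0]] : is_cycle_len (@redf f p) y (cycle_len (@redf f p) y).
  by rewrite /cycle_len; case: ex_minnP => l /asboolP.
exists (cycle_len (@redf f p) y); split => //.
- by have := cycle_len_lt y (ts p p_pr); rewrite card_ord.
- by have /dvdn_biglcmP := dvdnn (lambda f p); apply.
exists k0 => k hk.
apply: (dvdz_sub_trans (dvdz_sub_sym (redf_iter f (k + cycle_len (@redf f p) y) ya))).
apply: dvdz_sub_trans (redf_iter f k ya).
set l := cycle_len _ _ in hk0 *.
have -> : (k + l = (k - k0) + (k0 + l))%N by lia.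
by rewrite iterD -hk0 -iterD subnK // subrr dvdz0.
Qed.

(** The derivative of the [m]-th iterate of [f] at the orbit point of index [k]. *)
Definition multiplier (f : {poly int}) (a : int) (k m : nat) : int :=
  \prod_(i < m) f^`().[piter f (k + i) a].

Lemma multiplierD f a k m n :
  multiplier f a k (m + n) = multiplier f a k m * multiplier f a (k + m) n.
Proof.
rewrite /multiplier big_split_ord /=; congr (_ * _).
by apply: eq_bigr => i _; rewrite addnA.
Qed.

Lemma multiplier1 f a k : multiplier f a k 1 = f^`().[piter f k a].
Proof. by rewrite /multiplier big_ord1 addn0. Qed.

Lemma orbit_taylor f a (p d : int) k E m :
  (p %| d)%Z -> (d %| piter f (k + E) a - piter f k a)%Z ->
  (d * p %| piter f (k + E + m) a - piter f (k + m) a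
            - (piter f (k + E) a - piter f k a) * multiplier f a k m)%Z.
Proof.
move=> pd dE; have := piter_taylor f m pd dE.
rewrite -!piterD; congr (_ %| _ - _ * _)%Z.
by apply: eq_bigr => i _; rewrite piterD.
Qed.

Lemma dvdz_mulB (d x y z t : int) :
  (d %| x - y)%Z -> (d %| z - t)%Z -> (d %| x * z - y * t)%Z.
Proof.
move=> h1 h2; have -> : x * z - y * t = (x - y) * z + y * (z - t) by ring.
by apply: rpredD; [apply: dvdz_mulr | apply: dvdz_mull].
Qed.

Lemma dvdz_expB (d x y : int) n : (d %| x - y)%Z -> (d %| x ^+ n - y ^+ n)%Z.
Proof.
by move=> h; elim: n => [|n IH]; rewrite ?expr0 ?subrr ?dvdz0 // !exprS dvdz_mulB.
Qed.

Lemma dvdz_transfer (d x y : int) : (d %| x - y)%Z -> (d %| x)%Z = (d %| y)%Z.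
Proof. by move=> h; rewrite -[x in LHS](subrK y) rpredDl. Qed.

Section PrimeOrbit.
Variables (f : {poly int}) (a : int) (p : nat) (p_pr : prime p).
Local Notation u k := (piter f k a).
Local Notation mult := (multiplier f a).

(** * Multipliers modulo a prime *)

Section Multiplier.
Variables (L K : nat).
Hypothesis L_gt0 : (0 < L)%N.
Hypothesis perL : forall k : nat, (K <= k)%N -> (p %| u (k + L) - u k)%Z.

Lemma multiplier_shift k m : (K <= k)%N -> (p %| mult (k + L) m - mult k m)%Z.
Proof.
move=> hk; elim: m => [|m IH]; first by rewrite /multiplier !big_ord0 subrr dvdz0.
rewrite -addn1 !multiplierD !multiplier1; apply: dvdz_mulB => //.
by rewrite addnAC; apply/dvdz_horner/perL; lia.
Qed.

Lemma multiplier_exp k m : (K <= k)%N -> (p %| mult k (L * m) - mult k L ^+ m)%Z.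
Proof.
elim: m k => [|m IH] k hk; first by rewrite muln0 expr0 /multiplier big_ord0 subrr dvdz0.
rewrite mulnS multiplierD exprS; apply: dvdz_mulB; first by rewrite subrr dvdz0.
by apply: dvdz_sub_trans (IH k hk); apply: multiplier_shift.
Qed.

(** Shifting the window by one trades a factor for a congruent one. If that factor is nonzero modulo
    [p] it cancels; otherwise both products contain a factor divisible by [p]. *)
Lemma multiplier_dvd k : (K <= k)%N -> (p %| mult k L)%Z = (p %| mult K L)%Z.
Proof.
elim: k => [|k IH]; first by rewrite leqn0 => /eqP->.
rewrite leq_eqVlt => /orP [/eqP <- //|]; rewrite ltnS => hk; rewrite -IH //.
have e : mult k L * f^`().[u (k + L)] = f^`().[u k] * mult k.+1 L.
  by rewrite -!multiplier1 -(addn1 k) -!multiplierD [(L + 1)%N]addnC.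
have h := dvdz_horner f^`() (perL hk).
have pE (x y : int) : (p %| x * y)%Z = (p %| x)%Z || (p %| y)%Z.
  by rewrite !dvdzE abszM Euclid_dvdM.
case: (boolP (p %| f^`().[u k])%Z) => hf; last first.
  have := pE (mult k L) f^`().[u (k + L)].
  by rewrite e pE (dvdz_transfer h) (negPf hf) orbF.
have pk m : (K <= m)%N -> (p %| f^`().[u m])%Z -> (p %| mult m L)%Z.
  move=> _ hm; have := multiplierD f a m 1 L.-1.
  rewrite add1n prednK // multiplier1 => ->; exact: dvdz_mulr.
rewrite (pk k) //; have := multiplierD f a k.+1 L.-1 1; rewrite addn1 prednK // multiplier1 => ->.
rewrite dvdz_mull //.
by rewrite addSnnS prednK // (dvdz_transfer h).
Qed.

Lemma fermat_int (x : int) : ~~ (p %| x)%Z -> (p %| x ^+ p.-1 - 1)%Z.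
Proof.
move=> npx; have p0 := prime_gt0 p_pr.
have pZ : p%:Z != 0 by lia.
pose r := `|(x %% p)%Z|%N.
have rE : r%:Z = (x %% p)%Z by rewrite gez0_abs // modz_ge0.
have hr : (p %| x - r%:Z)%Z by rewrite rE -eqz_mod_dvd modz_mod.
have cop : coprime r p.
  rewrite coprime_sym prime_coprime //; move: npx.
  by rewrite (dvdz_transfer hr) dvdzE.
apply: dvdz_sub_trans (dvdz_expB _ hr) _.
have e : r%:Z ^+ p.-1 = (r ^ p.-1)%N%:Z by rewrite -!natz natrX.
rewrite -eqz_mod_dvd e !modz_nat -totient_prime //.
by apply/eqP; congr Posz; apply: Euler_exp_totient.
Qed.

(** Going [p.-1] times around the cycle raises the multiplier to the power [p.-1], which by Fermat
    is 0 or 1 modulo [p]. *)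
Lemma multiplier_dichotomy :
  (forall k, (K <= k)%N -> (p %| mult k (L * p.-1))%Z) \/
  (forall k t, (K <= k)%N -> (p %| mult k (t * (L * p.-1)) - 1)%Z).
Proof.
have p1 := prime_gt1 p_pr.
case: (boolP (p %| mult K L)%Z) => h; [left|right] => k.
  move=> hk; rewrite (dvdz_transfer (multiplier_exp _ hk)).
  by rewrite -(prednK (_ : 0 < p.-1)%N) ?exprS ?dvdz_mulr ?multiplier_dvd //; lia.
move=> t hk; rewrite mulnC -mulnA.
apply: dvdz_sub_trans (multiplier_exp _ hk) _.
rewrite exprM -[1](expr1n _ t); apply/dvdz_expB/fermat_int.
by rewrite multiplier_dvd.
Qed.
End Multiplier.

(** * Eventual periods modulo powers of a prime *)

Section Period.
Variables (D K : nat).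
Hypothesis perD : forall k : nat, (K <= k)%N -> (p %| u (k + D) - u k)%Z.

Lemma PoszX_S n : ((p ^ n.+1)%N : int) = (p ^ n)%N%:Z * p%:Z.
Proof. by rewrite expnSr PoszM. Qed.

Lemma dvd_pX n : (p %| (p ^ n.+1)%N%:Z)%Z.
Proof. by rewrite PoszX_S dvdz_mull. Qed.

(** By Taylor, moving on by [D] multiplies the difference over one period by a multiplier divisible
    by [p], up to a higher power of [p]. *)
Lemma attracting_period :
  (forall k, (K <= k)%N -> (p %| mult k D)%Z) ->
  forall n k, (K + D * n <= k)%N -> ((p ^ n.+1)%N %| u (k + D) - u k)%Z.
Proof.
move=> attr; elim=> [|n IH] k hk; first by rewrite expn1; apply: perD; lia.
have hk' : (K + D * n <= k - D)%N by lia.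
have ek : (k = k - D + D)%N by nia.
rewrite PoszX_S; have := orbit_taylor D (dvd_pX n) (IH _ hk').
rewrite -ek => h; rewrite (dvdz_transfer h).
apply: dvdz_mul; first by rewrite [in u k]ek; apply: IH.
by apply: attr; lia.
Qed.

(** With multipliers 1 modulo [p], successive differences over [E = D * p ^ n] agree with the first,
    [v], modulo [p ^ n.+2]. Summing [p] of them gives [p * v], which vanishes there. *)
Lemma neutral_period :
  (forall k t, (K <= k)%N -> (p %| mult k (t * D) - 1)%Z) ->
  forall n k, (K <= k)%N -> ((p ^ n.+1)%N %| u (k + D * p ^ n) - u k)%Z.
Proof.
move=> neut; elim=> [|n IH] k hk; first by rewrite expn1 muln1; apply: perD.
set E := (D * p ^ n)%N in IH *; set v := u (k + E) - u k.
have stp j : ((p ^ n.+2)%N %| u (k + j.+1 * E) - u (k + j * E) - v)%Z.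
  rewrite PoszX_S; have h := orbit_taylor (j * E) (dvd_pX n) (IH _ hk).
  rewrite mulSn addnA; apply: dvdz_sub_trans h _.
  have -> : (u (k + E) - u k) * mult k (j * E) - v = v * (mult k (j * E) - 1).
    by rewrite /v; ring.
  apply: dvdz_mul; first exact: IH.
  have -> : (j * E = j * p ^ n * D)%N by rewrite /E mulnA mulnAC.
  exact: neut.
have tot j : ((p ^ n.+2)%N %| u (k + j * E) - u k - j%:Z * v)%Z.
  elim: j => [|j IHj]; first by rewrite addn0 subrr mul0r subrr dvdz0.
  have -> : u (k + j.+1 * E) - u k - j.+1%:Z * v =
    (u (k + j.+1 * E) - u (k + j * E) - v) + (u (k + j * E) - u k - j%:Z * v).
    by rewrite -addn1 PoszD; ring.
  exact: rpredD.
rewrite expnSr mulnA mulnC (dvdz_transfer (tot p)) PoszX_S mulrC.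
by rewrite dvdz_mul // IH.
Qed.

Lemma attracting_recurrence :
  (0 < D)%N -> (forall k, (K <= k)%N -> (p %| mult k D)%Z) ->
  exists X0, forall n k, (X0 <= k)%N ->
    (forall T, exists2 t, (T <= t)%N & ((p ^ n.+1)%N %| u (k + t * D) - k%:Z)%Z) ->
    ((p ^ n.+1)%N %| u k - k%:Z)%Z.
Proof.
move=> D0 attr; have [h hE] := piter_poly f D.
have p1 := prime_gt1 p_pr.
(* If the [D]-th iterate were the identity, its derivative at [u K] would be 1 modulo [p], whereas
   the multiplier there is 0. *)
have F0 : h - 'X != 0.
  apply/eqP => /eqP; rewrite subr_eq0 => /eqP hX.
  have eK : u K + p%:Z - u K = p%:Z by ring.
  have pp : (p %| u K + p%:Z - u K)%Z by rewrite eK.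
  have := piter_taylor f D (dvdzz p%:Z) pp.
  rewrite -!hE hX !hornerX eK -[X in X - _]mulr1 -mulrBr dvdz_mul2l; last by lia.
  have -> : \prod_(i < D) f^`().[piter f i (u K)] = mult K D.
    by apply: eq_bigr => i _; rewrite piterD.
  move=> h1; have := rpredD h1 (attr K (leqnn K)); rewrite subrK.
  by rewrite dvdzE dvdn1; lia.
have [X0 hX0] := poly_dvd_pow2 K D F0.
exists X0 => n k hk rec.
have [t ht hkt] := rec (K + D * n)%N.
have big : (K + D * n <= k + t * D)%N by nia.
(* As [k] is congruent to a late orbit value, it is fixed by the [D]-th iterate modulo [p ^ n.+1],
   so growth puts it past the preperiod. *)
have hk2 : (K + D * n <= k)%N.
  suff : (K + D * n.+1 <= k)%N by nia.
  apply: (hX0 k n.+1 p hk p1); rewrite !hornerE hE.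
  apply: (dvdz_sub_trans (dvdz_piter f D (dvdz_sub_sym hkt))).
  by rewrite -piterD; apply: dvdz_sub_trans hkt; apply: attracting_period.
apply: dvdz_sub_trans hkt; apply/dvdz_sub_sym.
by apply: dvdz_piter_addM hk2 => *; apply: attracting_period.
Qed.
End Period.
End PrimeOrbit.

(** * Solutions along residue classes *)

Definition below (p : nat) : nat_pred := [pred q : nat | (q < p)%N].

Lemma evper_dvd f a (m M M' : nat) :
  (M %| M')%N -> evper f a m M -> evper f a m M'.
Proof.
move=> /dvdnP [t ->] [K h]; exists K => k hk; exact: dvdz_piter_addM h k hk.
Qed.

(** The exponent of a prime in [D] is less than [D]. *)
Lemma dvdn_exp_primes (D b N : nat) : (0 < D)%N -> (D <= N)%N -> (0 < b)%N ->
  (forall q, prime q -> (q %| D)%N -> (q %| b)%N) -> (D %| b ^ N)%N.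
Proof.
move=> D0 DN b0 h; apply/dvdn_partP => // q; rewrite mem_primes => /and3P [qp _ qD].
rewrite p_part (@dvdn_trans (q ^ N)%N) ?dvdn_exp2r ?h //.
by rewrite dvdn_exp2l // (leq_trans _ DN) // ltnW // ltn_logl.
Qed.

(* The period D p^n is replaced by the multiple (b^N)`_(below p) * p^n, in which
   D no longer appears, so that all primes p can share one N. *)
Lemma prime_power_dynamics f a (b p : nat) :
  tower_stable f -> f_valid f b -> prime p -> (p %| b)%N ->
  exists N0, forall N, (N0 <= N)%N ->
    (forall n, evper f a (p ^ n.+1) ((b ^ N)`_(below p) * p ^ n)) /\
    (forall n k, (N <= k)%N ->
      (forall T, exists2 t, (T <= t)%N &
         ((p ^ n.+1)%N %| piter f (k + t * ((b ^ N)`_(below p) * p ^ n)) a - k%:Z)%Z) ->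
      ((p ^ n.+1)%N %| piter f k a - k%:Z)%Z).
Proof.
move=> ts [[b0 _] [[_ bval] bf]] p_pr pb.
have [L [L0 Lp Ldvd [K perL]]] := orbit_cycle a p_pr ts.
have p1 := prime_gt1 p_pr.
set D := (L * p.-1)%N.
have D0 : (0 < D)%N by rewrite muln_gt0 L0; lia.
have perD k : (K <= k)%N -> (p %| piter f (k + D) a - piter f k a)%Z.
  by rewrite /D mulnC; apply: dvdz_piter_addM perL k.
(* Primes of [L] divide [b] through [lambda f p], those of [p.-1] by validity; the bound for the
   former is [L < p]. *)
have Dq q : prime q -> (q %| D)%N -> (q %| b)%N && (q < p)%N.
  move=> qp; rewrite Euclid_dvdM // => /orP [qL|qp1].
    rewrite (bf p q) ?(dvdn_trans qL) //=.
    by apply: leq_ltn_trans Lp; apply: dvdn_leq.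
  by rewrite (bval p q) //=; have /dvdn_leq := qp1; lia.
have DQ N : (D <= N)%N -> (D %| (b ^ N)`_(below p))%N.
  move=> hN; have /part_pnat_id <- : (below p).-nat D.
    by apply/pnatP => // q qp /(Dq q qp) /andP [].
  apply: partn_dvd; first by rewrite expn_gt0 b0.
  by apply: dvdn_exp_primes => // q qp /(Dq q qp) /andP [].
have [attr|neut] := multiplier_dichotomy p_pr L0 perL.
  have [X0 hX0] := attracting_recurrence p_pr perD D0 attr.
  exists (D + X0)%N => N hN; have /DQ /dvdnP [c cE] : (D <= N)%N by lia.
  rewrite cE; split=> n.
    apply: (@evper_dvd f a _ D); first by rewrite dvdn_mulr // dvdn_mull.
    by exists (K + D * n)%N => k; apply: attracting_period.
  move=> k hk rec; apply: hX0 => [|T]; first by lia.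
  have [t ht h] := rec T; exists (t * (c * p ^ n))%N.
    have : (0 < c)%N by case: (c) cE => // /eqP; rewrite mul0n eqn0Ngt part_gt0.
    have pn0 : (0 < p ^ n)%N by rewrite expn_gt0 prime_gt0.
    by move=> c0; rewrite (leq_trans ht) // leq_pmulr // muln_gt0 c0.
  by rewrite -mulnA mulnAC.
exists (D + K)%N => N hN; have /DQ DN : (D <= N)%N by lia.
have per n k : (K <= k)%N -> ((p ^ n.+1)%N %| piter f (k + (b ^ N)`_(below p) * p ^ n) a
    - piter f k a)%Z.
  have /dvdnP [c ->] := DN; rewrite -mulnA => hk.
  by apply: dvdz_piter_addM hk; apply: neutral_period.
split=> n; first by exists K; apply: per.
move=> k hk rec; have [t _ h] := rec 0%N.
apply: dvdz_sub_trans h; apply: dvdz_sub_sym.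
by apply: (@dvdz_piter_addM _ _ _ _ K) => *; [apply: per|lia].
Qed.

Lemma eventually_all (P : nat -> nat -> Prop) (s : seq nat) :
  (forall p, p \in s -> exists N0, forall N, (N0 <= N)%N -> P p N) ->
  exists N0, forall N, (N0 <= N)%N -> forall p, p \in s -> P p N.
Proof.
elim: s => [|x s IH] h; first by exists 0%N.
have [|N1 h1] := IH; first by move=> p ps; apply: h; rewrite inE ps orbT.
have [N2 h2] := h x (mem_head x s).
exists (maxn N1 N2) => N; rewrite geq_max => /andP [hN1 hN2] p.
by rewrite inE => /orP [/eqP ->|]; [apply: h2|apply: h1].
Qed.

Lemma dvdz_partP (m : nat) (z : int) : (0 < m)%N ->
  (forall q, prime q -> (q %| m)%N -> ((m`_q)%N %| z)%Z) -> (m %| z)%Z.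
Proof.
move=> m0 h; rewrite dvdzE absz_nat; apply/dvdn_partP => // q.
by rewrite mem_primes => /and3P [qp _ qm]; have := h q qp qm; rewrite dvdzE.
Qed.

Lemma evper_parts f a (m M : nat) : (0 < m)%N ->
  (forall q, prime q -> (q %| m)%N -> evper f a m`_q M) -> evper f a m M.
Proof.
move=> m0 h.
have [|K hK] := @eventually_all
    (fun q k => ((m`_q)%N %| piter f (k + M) a - piter f k a)%Z) (primes m).
  by move=> q; rewrite mem_primes => /and3P [qp _ qm]; apply: h.
exists K => k hk; apply: dvdz_partP => // q qp qm; apply: hK => //.
by rewrite mem_primes qp m0.
Qed.

(** Only large indices are tested, since [x] itself may precede the preperiod. *)
Definition progression_solution f a (M x : nat) : Prop :=
  exists T, forall t : nat, (T <= t)%N -> (M %| piter f (x + t * M) a - x%:Z)%Z.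

(** All large indices in the class of [x] modulo [M] give one value [x + w * M] modulo [M * s]; the
    new digit [c] is [w] modulo [s]. *)
Lemma progression_solution_step f a (M s x : nat) : (0 < M)%N -> (0 < s)%N ->
  evper f a (M * s) M -> progression_solution f a M x ->
  exists2 c, (c < s)%N & progression_solution f a (M * s) (c * M + x).
Proof.
move=> M0 s0 [K per] [T sol].
set T' := (T + K)%N; pose y := piter f (x + T' * M) a.
have /dvdzP [w wE] : (M %| y - x%:Z)%Z by apply: sol; lia.
have sZ : s%:Z != 0 by lia.
pose c := `|(w %% s)%Z|%N.
have cE : c%:Z = (w %% s)%Z by rewrite gez0_abs // modz_ge0.
have cy : ((M * s)%N %| y - (c * M + x)%N%:Z)%Z.
  apply/dvdzP; exists (w %/ s)%Z.
  have : y = w * M%:Z + x%:Z by rewrite -wE subrK.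
  by rewrite PoszD !PoszM cE {1}(divz_eq w s) => ->; ring.
exists c; first by rewrite -ltz_nat cE ltz_pmod.
exists T' => t ht; apply: dvdz_sub_trans cy.
have [r ->] : exists r, (c * M + x + t * (M * s) = x + T' * M + r * M)%N.
  exists (c + t * s - T')%N; have hT : (T' <= c + t * s)%N by nia.
  by rewrite -(addnA x) -mulnDl subnKC // mulnDl -mulnA [(s * M)%N]mulnC addnCA addnA.
by apply: dvdz_piter_addM per _ _; nia.
Qed.

Lemma partn_below_succ (m r : nat) : (0 < m)%N ->
  (m`_(below r.+1) = m`_(below r) * m`_r)%N.
Proof.
move=> m0; rewrite -(partnC (below r) (part_gt0 (below r.+1) m)) -!partnI.
congr (_ * _)%N; apply: eq_partn => q; rewrite !inE /=; lia.
Qed.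

Lemma logn_squarefree b p : squarefree b -> prime p -> (p %| b)%N -> logn p b = 1%N.
Proof.
move=> [b0 sf] pp pb; have := sf p pp; rewrite pfactor_dvdn //.
by have : (0 < logn p b)%N; [rewrite logn_gt0 mem_primes pp b0 | lia].
Qed.

Lemma progression_solution_shift f a (M x j : nat) :
  progression_solution f a M x -> progression_solution f a M (x + j * M).
Proof.
move=> [T sol]; exists T => t ht; rewrite -addnA -mulnDl.
have h := sol (j + t)%N (leq_trans ht (leq_addl _ _)).
by apply: dvdz_sub_trans h _; rewrite PoszD opprD addNKr rpredN PoszM dvdz_mull.
Qed.

Lemma dvdn_below_part (b p N m n : nat) : prime p -> (p %| b)%N -> (0 < b)%N ->
  (N <= n)%N -> (m <= n)%N -> ((b ^ N)`_(below p) * p ^ m %| b ^ n)%N.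
Proof.
move=> pp pb b0 hN hm; rewrite Gauss_dvd; last first.
  apply: (@pnat_coprime (below p)); first exact: part_pnat.
  by rewrite pnatX pnatE // !inE ltnn.
apply/andP; split; first exact: dvdn_trans (dvdn_part _ _) (dvdn_exp2l _ hN).
exact: dvdn_trans (dvdn_exp2l _ hm) (dvdn_exp2r _ pb).
Qed.

(** * Lifting through the prime powers dividing [b ^ N], then through powers of [b] *)

Section Chain.
Variables (f : {poly int}) (a : int) (b N : nat).
Hypotheses (b_sf : squarefree b) (N_gt0 : (0 < N)%N).
Hypothesis per : forall p, prime p -> (p %| b)%N ->
  forall n, evper f a (p ^ n.+1) ((b ^ N)`_(below p) * p ^ n).

Let b_gt0 : (0 < b)%N. Proof. by case: b_sf. Qed.
Let bN_gt0 n : (0 < b ^ n)%N. Proof. by rewrite expn_gt0 b_gt0. Qed.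

Lemma exp_part p n : prime p -> (p %| b)%N -> ((b ^ n)`_p = p ^ n)%N.
Proof. by move=> pp pb; rewrite partnX p_part logn_squarefree // expn1. Qed.

Lemma evper_dvdl (m m' M : nat) : (m %| m')%N -> evper f a m' M -> evper f a m M.
Proof.
by move=> h [K hK]; exists K => k /hK; apply: dvdz_trans; rewrite dvdzE.
Qed.

(* The modulus runs through (b^N)`_(below p) * p^m, m <= N: the periods modulo
   p^(m+1) and modulo the smaller prime powers q^N divide the current modulus. *)
Lemma evper_chain p m : prime p -> (p %| b)%N -> (m < N)%N ->
  evper f a ((b ^ N)`_(below p) * p ^ m * p) ((b ^ N)`_(below p) * p ^ m).
Proof.
move=> pp pb mN; rewrite -mulnA -expnSr.
have cop : coprime (b ^ N)`_(below p) (p ^ m.+1).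
  apply: (@pnat_coprime (below p)); first exact: part_pnat.
  by rewrite pnatX pnatE // !inE ltnn.
apply: evper_parts => [|q qp]; first by rewrite muln_gt0 part_gt0 expn_gt0 prime_gt0.
rewrite Euclid_dvdM // => /orP [qQ|]; last first.
  rewrite Euclid_dvdX // andbT dvdn_prime2 // => /eqP ->.
  rewrite p_part lognM ?part_gt0 ?expn_gt0 ?prime_gt0 // pfactorK //.
  suff -> : logn p (b ^ N)`_(below p) = 0%N by apply: per.
  by rewrite logn_coprime //; move: cop; rewrite coprime_pexpr // coprime_sym.
have qb : (q %| b)%N.
  by have := dvdn_trans qQ (dvdn_part _ _); rewrite Euclid_dvdX // => /andP [].
have qlt : (q < p)%N.
  by have /pnatP := part_pnat (below p) (b ^ N); apply=> //; rewrite part_gt0.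
apply: (@evper_dvdl _ (q ^ N.-1.+1)).
  rewrite prednK // -(exp_part N qp qb); apply: partn_dvd => //.
  exact: dvdn_below_part.
apply: evper_dvd (per qp qb _).
apply: dvdn_mulr; apply: (@dvdn_trans (b ^ N)`_(below q.+1)).
  by rewrite partn_below_succ // exp_part // dvdn_mul // dvdn_exp2l // leq_pred.
by apply: sub_in_partn => r _; rewrite !inE => h; apply: leq_trans qlt.
Qed.

Lemma progression_solution_below r :
  exists x, progression_solution f a (b ^ N)`_(below r) x.
Proof.
elim: r => [|r [x hx]].
  exists 0%N, 0%N => t _; rewrite part_p'nat ?dvd1z //.
  by apply/pnatP => // q qp _; rewrite !inE.
rewrite partn_below_succ //.
case: (boolP (prime r && (r %| b)%N)) => [/andP [rp rb]|nr]; last first.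
  have part1 : ((b ^ N)`_r = 1)%N by rewrite p_part lognX lognE b_gt0 (negPf nr) muln0.
  by exists x; rewrite part1 muln1.
rewrite exp_part //.
(* [N] lifts by the factor [r] bring in the full power [r ^ N]. *)
have chain m : (m <= N)%N ->
    exists y, progression_solution f a ((b ^ N)`_(below r) * r ^ m) y.
  elim: m => [|m IH] mN; first by exists x; rewrite muln1.
  have [y hy] := IH (ltnW mN).
  have [||c _ hc] := progression_solution_step _ _ (evper_chain rp rb mN) hy.
  - by rewrite muln_gt0 part_gt0 expn_gt0 prime_gt0.
  - exact: prime_gt0.
  by exists (c * ((b ^ N)`_(below r) * r ^ m) + y)%N; rewrite expnSr mulnA.
exact: chain.
Qed.

Lemma progression_solution_base : exists x, progression_solution f a (b ^ N) x.
Proof.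
have [x hx] := progression_solution_below b.+1; exists x.
move: hx; rewrite part_pnat_id //; apply/pnatP => // q qp.
by rewrite Euclid_dvdX // => /andP [/dvdn_leq qb _]; rewrite !inE ltnS qb.
Qed.

(** For each prime [q] dividing [b], the period modulo [q ^ n.+1] divides [b ^ n] once [N <= n]. *)
Lemma evper_tower n : (N <= n)%N -> evper f a (b ^ n * b) (b ^ n).
Proof.
move=> nN; rewrite -expnSr; apply: evper_parts => // q qp.
rewrite Euclid_dvdX // => /andP [qb _]; rewrite exp_part //.
by apply: evper_dvd (per qp qb n); apply: dvdn_below_part.
Qed.

Hypothesis rec : forall p, prime p -> (p %| b)%N -> forall n k, (N <= k)%N ->
  (forall T, exists2 t, (T <= t)%N &
     ((p ^ n.+1)%N %| piter f (k + t * ((b ^ N)`_(below p) * p ^ n)) a - k%:Z)%Z) ->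
  ((p ^ n.+1)%N %| piter f k a - k%:Z)%Z.

(** Passes from large indices to [x] itself, prime by prime: steps of [b ^ n] are multiples of the
    steps in [rec]. *)
Lemma progression_solution_fixed n x : (N <= n)%N -> (N <= x)%N ->
  progression_solution f a (b ^ n) x -> ((b ^ n)%N %| piter f x a - x%:Z)%Z.
Proof.
case: n => [|n nN xN [T sol]]; first by lia.
apply: dvdz_partP => // q qp; rewrite Euclid_dvdX // => /andP [qb _].
rewrite exp_part //; apply: rec => // T'.
have /dvdnP [s sE] := dvdn_below_part qp qb b_gt0 nN (leqnSn n).
exists ((T + T') * s)%N.
  have : (0 < s)%N by have := bN_gt0 n.+1; rewrite sE muln_gt0 => /andP [].
  by nia.
rewrite -mulnA -sE; apply: dvdz_trans (sol _ (leq_addr _ _)).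
by rewrite dvdzE dvdn_exp2r.
Qed.
End Chain.

Theorem theorem1p5 (f : {poly int}) (a : int) (b : nat) :
  tower_stable f -> (0 < a)%R -> (0 < b)%N -> f_valid f b ->
  exists x : nat -> nat,
    (forall n : nat, (1 <= n)%N ->
       (0 < x n)%N /\ (piter f (x n) a = (x n)%:Z %[mod ((b ^ n)%N)%:Z])%Z) /\
    (forall n : nat, (2 <= n)%N ->
       exists c : nat, (c < b)%N /\ x n = (c * b ^ n.-1 + x n.-1)%N).
Proof.
move=> ts _ b0 fv; have [sf _] := fv.
have [|N0 hN0] := eventually_all (s := primes b) (P := fun p N =>
    (forall n, evper f a (p ^ n.+1) ((b ^ N)`_(below p) * p ^ n)) /\
    (forall n k, (N <= k)%N ->
      (forall T, exists2 t, (T <= t)%N &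
         ((p ^ n.+1)%N %| piter f (k + t * ((b ^ N)`_(below p) * p ^ n)) a - k%:Z)%Z) ->
      ((p ^ n.+1)%N %| piter f k a - k%:Z)%Z)).
  move=> p; rewrite mem_primes => /and3P [pp _ pb].
  exact: prime_power_dynamics.
(* Positivity of [N] makes each [p ^ N] of the form [p ^ n.+1]. *)
set N := N0.+1.
have b_primes p (pp : prime p) (pb : (p %| b)%N) : p \in primes b.
  by rewrite mem_primes pp b0.
have per p pp pb := (hN0 N (leqnSn _) p (b_primes p pp pb)).1.
have rec p pp pb := (hN0 N (leqnSn _) p (b_primes p pp pb)).2.
have [z hz] := progression_solution_base sf (ltn0Sn N0) per.
(* The digit is a total function, 0 by default, so that the recursion can be defined before its
   invariant is proved. *)
have [c hc] : {c : nat * nat -> nat & forall nx, (N <= nx.1)%N ->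
    progression_solution f a (b ^ nx.1) nx.2 -> (c nx < b)%N /\
    progression_solution f a (b ^ nx.1.+1) (c nx * b ^ nx.1 + nx.2)}.
  apply: (@choice _ _ (fun nx c => (N <= nx.1)%N ->
    progression_solution f a (b ^ nx.1) nx.2 -> (c < b)%N /\
    progression_solution f a (b ^ nx.1.+1) (c * b ^ nx.1 + nx.2))).
  move=> [n x] /=; have [hn|] := leqP N n; last by exists 0%N.
  case: (EM (progression_solution f a (b ^ n) x)) => [sol|]; last by exists 0%N.
  have bn0 : (0 < b ^ n)%N by rewrite expn_gt0 b0.
  have [c cb hc] := progression_solution_step bn0 b0 (evper_tower sf per hn) sol.
  by exists c => _ _; rewrite expnSr.
(* Adding [N * b ^ N] keeps the class modulo [b ^ N] and makes every term at least [N], as [rec]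
   requires. *)
pose y := nat_rect (fun=> nat) (z + N * b ^ N)%N
  (fun j yj => c (N + j, yj) * b ^ (N + j) + yj)%N.
have yS j : y j.+1 = (c (N + j, y j) * b ^ (N + j) + y j)%N by [].
have solN j : progression_solution f a (b ^ (N + j)) (y j).
  elim: j => [|j IH]; first by rewrite addn0; apply: progression_solution_shift.
  by have [_] := hc (N + j, y j)%N (leq_addr _ _) IH; rewrite addnS.
have yN j : (N <= y j)%N.
  elim: j => [|j IH] /=; last by rewrite (leq_trans IH) ?leq_addl.
  by rewrite (leq_trans _ (leq_addl _ _)) // leq_pmulr // expn_gt0 b0.
have yfix j : ((b ^ (N + j))%N %| piter f (y j) a - (y j)%:Z)%Z.
  by apply: (progression_solution_fixed sf _ rec) => //; rewrite leq_addr.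
(* truncated subtraction: the sequence is constant up to n = N *)
exists (fun n => y (n - N)%N); split=> n hn.
  split; first exact: leq_trans (yN _).
  apply/eqP; rewrite eqz_mod_dvd; apply: dvdz_trans (yfix _).
  by rewrite dvdzE dvdn_exp2l //; lia.
have [nN|Nn] := leqP n N.
  by exists 0%N; split => //; have -> : (n.-1 - N = n - N)%N by lia.
have -> : (n - N = (n.-1 - N).+1)%N by lia.
have e : (N + (n.-1 - N) = n.-1)%N by lia.
exists (c (N + (n.-1 - N), y (n.-1 - N)))%N; split; last by rewrite yS e.
by have [] := hc (N + (n.-1 - N), y (n.-1 - N))%N (leq_addr _ _) (solN _).
Qed.
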